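(* Let $(X,d,\nu)$ be a metric measure space with $\nu(X)=+\infty$. Let $f:[0,\infty)\to[0,\infty)$ be a convex increasing function with $f(0)=0$. Assume that $\nu$ is $f$-Ahlfors regular, i.e. there exist $C_{f,a},C_{f,A}>0$ such that $$C_{f,a}f(r)\le\nu(B(x,r))\le C_{f,A}f(r)\qquad\text{for all }x\in X,\ r>0 .$$ Then for all $p\in[1,\infty)$ and all $u\in L^p(X,\nu)$, $$c_1\|u\|_{L^p(X,\nu)}^p\le \bigg[\frac{u(x)-u(y)}{f(d(x,y))^{\frac 1p}}\bigg]^p_{L^p_w(X\times X,\nu\otimes\nu)}\le c_2\|u\|_{L^p(X,\nu)}^p$$ with $c_1=2C_{f,a}$ and $c_2=2^{p+1}C_{f,A}$. Furthermore, setting $$E_\lambda^f=\bigg\{(x,y)\in X\times X:\ \frac{|u(x)-u(y)|}{f(d(x,y))^{\frac 1p}}\ge\lambda\bigg\}\qquad(\lambda>0),$$ one has $$2C_{f,a}\|u\|_{L^p(X,\nu)}^p\le\liminf_{\lambda\to0^+}\lambda^p(\nu\otimes\nu)(E_\lambda^f)\le\limsup_{\lambda\to0^+}\lambda^p(\nu\otimes\nu)(E_\lambda^f)\le 2C_{f,A}\|u\|_{L^p(X,\nu)}^p .$$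
   Context: A metric measure space is a triple $(X,d,\nu)$, where $(X,d)$ is a complete and separable metric space and $\nu$ is a nonzero non-negative Borel measure on $X$ that is finite on bounded sets. $B(x,r)=\{y\in X: d(x,y)<r\}$ is the ball with center $x$ and radius $r>0$. Functions $u$ are real-valued. ''Increasing'' means strictly increasing. For a measure space $(Z,\mu)$, $p\ge 1$ and a $\mu$-measurable function $g:Z\to\mathbb{R}$, the weak-$L^p$ (Marcinkiewicz) quantity, raised to the power $p$, is $$[g]^p_{L^p_w(Z,\mu)}=\sup_{\lambda>0}\lambda^p\,\mu(\{z\in Z:\ |g(z)|\ge\lambda\}).$$ Here it is used with $Z=X\times X$ and $\mu=\nu\otimes\nu$. Difference quotients are taken to be $0$ on the diagonal $\{x=y\}$. *)

(* Defs.v *)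
From HB Require Import structures.
From mathcomp Require Import all_boot all_order all_algebra.
From mathcomp Require Import all_classical all_reals all_analysis.

Set Implicit Arguments.
Unset Strict Implicit.
Unset Printing Implicit Defensive.

Import Order.TTheory GRing.Theory Num.Theory.
Import numFieldNormedType.Exports.

Local Open Scope classical_set_scope.
Local Open Scope ring_scope.

(* [Complete] comes with a distinguished point; this excludes only the empty
   space, which carries no nonzero measure. *)
#[short(type="completeMetricType")]
HB.structure Definition CompleteMetric (R : numDomainType) :=
  {T of Metric R T & Complete T}.

Notation borel X := (g_sigma_algebraType (@open X)).

Definition separable (T : topologicalType) : Prop :=
  exists2 D : set T, countable D & dense D.

Definition metric_bounded (R : numDomainType) (X : metricType R)
    (A : set X) : Prop :=
  exists (x : X) (r : R), A `<=` ball x r.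

Definition metric_measure_space (R : realType) (X : completeMetricType R)
    (nu : {measure set (borel X) -> \bar R}) : Prop :=
  [/\ separable X,
      nu setT != 0%E
    & forall A : set (borel X),
        measurable A -> metric_bounded (A : set X) -> (nu A < +oo)%E].

Definition ahlfors_regular (R : realType) (X : completeMetricType R)
    (nu : {measure set (borel X) -> \bar R}) (f : R -> R) (Ca CA : R) : Prop :=
  forall (x : X) (r : R), 0 < r ->
    ((Ca * f r)%:E <= nu (ball x r) <= (CA * f r)%:E)%E.

(* [mu] is a bare set function so that it can be instantiated with
   [(nu \x nu)%E], which the library makes a {measure _} only for a [nu] bundled
   as sigma-finite; here sigma-finiteness is a consequence of finiteness on
   balls. *)
Definition weakLp_pow (R : realType) (Z : Type) (mu : set Z -> \bar R)
    (p : R) (g : Z -> R) : \bar R :=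
  ereal_sup [set ((lam `^ p)%:E * mu [set z | (lam <= `|g z|)%R])%E
            | lam in [set lam : R | (0 < lam)%R]].

(* The value on the diagonal is 0, since the numerator vanishes there and
   division is total. *)
Definition diff_quotient (R : realType) (X : metricType R) (f : R -> R)
    (p : R) (u : X -> R) (z : X * X) : R :=
  (u z.1 - u z.2) / f (mdist z.1 z.2) `^ p^-1.

Definition diff_level (R : realType) (X : metricType R) (f : R -> R)
    (p : R) (u : X -> R) (lam : R) : set (X * X) :=
  [set z | lam <= `|u z.1 - u z.2| / f (mdist z.1 z.2) `^ p^-1].

(* Main.v *)
(** Put [rho (x, y) = f (d (x, y))]. Being convex, increasing and null at 0, [f]
    is a bijection of [[0, +oo[], so Ahlfors regularity says that
    [{y | rho (x, y) <= t}] has measure between [Ca * t] and [CA * t] for all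
    [t >= 0]. No triangle inequality is needed beyond this, except to see that
    [d] is measurable on the product. A pair [(x, y)], [x <> y], lies in the level
    set of [lam] iff [rho (x, y) <= (`|u x - u y| / lam) ^ p].

    Upper bounds: if [`|u y| <= e * `|u x|] then [`|u x - u y|] is at most
    [(1 + e) * `|u x|], and Tonelli bounds the measure of such pairs by
    [CA * (1 + e) ^ p / lam ^ p] times the integral of [`|u| ^ p]; exchanging
    [x] and [y] gives the factor 2. With [e = 1] this covers all pairs and gives
    the constant [2 ^ (p + 1) * CA]. For the limsup, [e] is small; the remaining
    pairs either have values below a small height, where the integral is small,
    or lie in a fixed set of finite measure, which is killed by [lam ^ p].

    Lower bound: when [`|u x|] is above a height [eta] and [`|u y|] below
    [e * eta], [`|u x - u y|] is at least [(1 - e) * `|u x|]; discarding the [y]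
    with [`|u y| >= e * eta] costs only a finite measure, negligible after
    multiplication by [lam ^ p]. The supremum dominates the liminf. *)

Require Import Defs.
From HB Require Import structures.
From mathcomp Require Import all_boot all_order all_algebra.
From mathcomp Require Import all_classical all_reals all_analysis.
From mathcomp Require Import measurable_realfun.
From mathcomp Require Import ring lra.
Set Implicit Arguments.
Unset Strict Implicit.
Unset Printing Implicit Defensive.

Import Order.TTheory GRing.Theory Num.Theory.
Import numFieldNormedType.Exports.
Local Open Scope classical_set_scope.
Local Open Scope ring_scope.

(** * The product of a measure with itself: coordinate swap and one-sided Tonelli bounds *)

Section product_square.
Context d (T : measurableType d) (R : realType).
Variable nu : {sigma_finite_measure set T -> \bar R}.
Local Open Scope ereal_scope.

(** The left side unfolds to [nu \x^ nu] of [B], the integral of the sections in the other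
    direction; both products agree on rectangles, hence everywhere. *)
Lemma product_measure_swap (B : set (T * T)) : measurable B ->
  (nu \x nu) (swap_pair @^-1` B) = (nu \x nu) B.
Proof.
move=> mB; rewrite [RHS](@product_measure_unique _ _ _ _ _ nu nu (nu \x^ nu)%E)//.
by move=> A1 A2 mA1 mA2; exact: product_measure2E.
Qed.

Lemma measurable_preimage_swap (B : set (T * T)) :
  measurable B -> measurable (swap_pair @^-1` B).
Proof.
by move=> mB; rewrite -[X in measurable X]setTI; exact: measurable_swap.
Qed.

Lemma le_product_measureU_swap (B : set (T * T)) : measurable B ->
  (nu \x nu) (B `|` swap_pair @^-1` B) <= 2%:E * (nu \x nu) B.
Proof.
move=> mB; rewrite mule_natl mule2n -[X in _ <= _ + X]product_measure_swap//.
exact: (@measureU2 _ _ _ (nu \x nu) _ _ mB (measurable_preimage_swap mB)).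
Qed.

Lemma product_measureU_swap (B : set (T * T)) : measurable B ->
  [disjoint B & swap_pair @^-1` B] ->
  (nu \x nu) (B `|` swap_pair @^-1` B) = 2%:E * (nu \x nu) B.
Proof.
move=> mB /disj_set2P dB; 
rewrite mule_natl mule2n -[X in _ = _ + X]product_measure_swap//.
by apply: (@measureU _ _ _ (nu \x nu)) => //; exact: measurable_preimage_swap.
Qed.

Lemma le_product_measure (A B : set (T * T)) : measurable A -> measurable B ->
  A `<=` B -> (nu \x nu) A <= (nu \x nu) B.
Proof. by move=> mA mB; apply: (le_measure (nu \x nu)); rewrite inE. Qed.

Lemma le_integral_product_measure (B : set (T * T)) (D : set T) (g : T -> \bar R) :
  measurable B -> measurable D -> measurable_fun D g ->
  (forall x, D x -> 0 <= g x <= nu (xsection B x)) ->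
  \int[nu]_(x in D) g x <= (nu \x nu) B.
Proof.
move=> mB mD mg gB; have mnuB := measurable_fun_xsection nu mB.
apply: (@le_trans _ _ (\int[nu]_(x in D) nu (xsection B x))).
  apply: ge0_le_integral => //.
  - by move=> x Dx; case/andP: (gB x Dx).
  - exact: measurable_funTS.
  - by move=> x Dx; case/andP: (gB x Dx).
by apply: ge0_subset_integral => // x _; exact: measure_ge0.
Qed.

Lemma product_measure_le_integral (B : set (T * T)) (g : T -> \bar R) :
  measurable B -> measurable_fun setT g ->
  (forall x, nu (xsection B x) <= g x) -> (nu \x nu) B <= \int[nu]_x g x.
Proof.
move=> mB mg gB; apply: ge0_le_integral => //.
- exact: (measurable_fun_xsection nu mB).
- by move=> x _; exact: gB.
Qed.

End product_square.

(** * Level sets of difference quotients for an abstract symmetric gauge [rho] *)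

Section level_sets.
Context d (T : measurableType d) (R : realType).
Variable nu : {sigma_finite_measure set T -> \bar R}.
Variables (rho : T * T -> R) (Ca CA : R).
Hypothesis mrho : measurable_fun setT rho.
Hypothesis rho_ge0 : forall z, 0 <= rho z.
Hypothesis rho_gt0 : forall x y, x <> y -> 0 < rho (x, y).
Hypothesis rhoC : forall x y, rho (x, y) = rho (y, x).
Hypothesis Ca_ge0 : 0 <= Ca.
Hypothesis CA_ge0 : 0 <= CA.
Hypothesis nu_rho : forall x t, 0 <= t ->
  ((Ca * t)%:E <= nu [set y | (rho (x, y) <= t)%R] <= (CA * t)%:E)%E.
Variables (p : R) (u : T -> R).
Hypothesis p1 : 1 <= p.
Hypothesis mu : measurable_fun setT u.

Let p0 : 0 < p. Proof. by rewrite (lt_le_trans _ p1). Qed.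

Definition rho_level (lam : R) : set (T * T) :=
  [set z | lam <= `|u z.1 - u z.2| / rho z `^ p^-1].

(** The level-set condition with the numerator replaced by [c * |u z.1|]. The bound no longer
    involves [z.2], so each section over [D] is a sublevel set of [rho (x, _)], to which [nu_rho]
    applies. *)
Let near_set (c lam : R) (D : set T) : set (T * T) :=
  [set z | D z.1 /\ rho z <= (c * `|u z.1| / lam) `^ p].

Let mu1 : measurable_fun [set: T * T] (fun z => u z.1).
Proof. exact: measurableT_comp. Qed.

Let mu2 : measurable_fun [set: T * T] (fun z => u z.2).
Proof. exact: measurableT_comp. Qed.

Lemma measurable_rho_level lam : measurable (rho_level lam).
Proof.
rewrite -[X in measurable X]setTI; apply: measurable_fun_le => //.
apply: measurable_funM.
  by apply: measurableT_comp => //; exact: measurable_funB.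
under eq_fun do rewrite -powRN.
by apply: measurableT_comp (measurable_powR _) mrho.
Qed.

Lemma rho_level_swap lam : swap_pair @^-1` (rho_level lam) = rho_level lam.
Proof.
by apply/seteqP; split => -[x y]; rewrite /rho_level /= rhoC distrC.
Qed.

Let measurable_scaled c lam :
  measurable_fun setT (fun x => (c * `|u x| / lam) `^ p).
Proof.
apply: measurableT_comp (measurable_powR _) _.
apply: measurable_funM => //; apply: measurable_funM => //.
exact: measurableT_comp.
Qed.

Let measurable_near c lam D : measurable D -> measurable (near_set c lam D).
Proof.
move=> mD; rewrite (_ : near_set _ _ _ = (D `*` setT) `&`
    [set z | rho z <= (c * `|u z.1| / lam) `^ p]); last first.
  by apply/seteqP; split => z [] => [? ?|[? _] ?].
apply: measurable_fun_le => //.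
- exact: measurableX.
- exact: measurable_funTS.
- by apply: measurable_funTS; exact: (measurableT_comp (measurable_scaled c lam)).
Qed.

Lemma rho_levelP lam z : 0 < lam -> rho_level lam z ->
  rho z <= (`|u z.1 - u z.2| / lam) `^ p.
Proof.
move=> lam0; rewrite /rho_level /=.
(* Where [rho] vanishes the quotient is 0 by convention, but the claimed bound is then trivial. *)
have [r0 _|rn0] := eqVneq (rho z) 0; first by rewrite r0 powR_ge0.
have r0 : 0 < rho z by rewrite lt0r rn0 rho_ge0.
rewrite ler_pdivlMr ?powR_gt0// mulrC -ler_pdivlMr// => h.
rewrite -[leLHS](@powRr1 _ (rho z))// -(mulVf (lt0r_neq0 p0)) powRrM.
by apply: ge0_ler_powR => //; rewrite ?nnegrE ?powR_ge0 ?divr_ge0// ltW.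
Qed.

(** Converse of [rho_levelP], with any lower bound [c] of the difference. Off the diagonal [rho] is
    positive, so the division is genuine; on it the quotient is 0, below [lam]. *)
Lemma le_rho_level lam x y (c : R) : 0 < lam -> x <> y ->
  0 <= c <= `|u x - u y| -> rho (x, y) <= (c / lam) `^ p ->
  rho_level lam (x, y).
Proof.
move=> lam0 /rho_gt0 r0 /andP[c0 cu] h; rewrite /rho_level /=.
rewrite ler_pdivlMr ?powR_gt0// mulrC -ler_pdivlMr//.
apply: (@le_trans _ _ (c / lam)); last by rewrite ler_pM2r ?invr_gt0.
rewrite -[leRHS](@powRr1 _ (c / lam)) ?divr_ge0 ?(ltW lam0)//.
rewrite -(mulfV (lt0r_neq0 p0)) powRrM.
by apply: ge0_ler_powR => //; rewrite ?nnegrE ?powR_ge0 ?invr_ge0// ltW.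
Qed.

Let measurable_upow (D : set T) : measurable_fun D (fun x => (`|u x| `^ p)%:E).
Proof.
apply: measurable_funTS; apply/measurable_EFinP.
by apply: measurableT_comp (measurable_powR _) _; exact: measurableT_comp.
Qed.

(** The weight [lam ^ p] cancels exactly, which makes the bounds on [near_set] independent of
    [lam]. *)
Let scaled_powR c lam x : 0 <= c -> 0 < lam ->
  lam `^ p * (c * `|u x| / lam) `^ p = c `^ p * `|u x| `^ p.
Proof.
move=> c0 lam0; rewrite -!powRM//; last first.
- by rewrite !mulr_ge0// invr_ge0 ltW.
- exact: ltW.
by congr (_ `^ _); field; exact: lt0r_neq0.
Qed.

Lemma near_set_le c lam D : 0 <= c -> 0 < lam -> measurable D ->
  ((lam `^ p)%:E * (nu \x nu) (near_set c lam D) <=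
   (CA * c `^ p)%:E * \int[nu]_(x in D) (`|u x| `^ p)%:E)%E.
Proof.
move=> c0 lam0 mD.
(* The indicator moves the restriction to [D] into the integrand, since
   [product_measure_le_integral] integrates over the whole space; off [D] the sections are empty. *)
set h := fun x => (c * `|u x| / lam) `^ p * \1_D x.
have h0 x : 0 <= h x by rewrite mulr_ge0// powR_ge0.
have mh : measurable_fun setT h.
  by apply: measurable_funM => //; exact: measurable_indic.
have -> : ((CA * c `^ p)%:E * \int[nu]_(x in D) (`|u x| `^ p)%:E =
    (lam `^ p)%:E * \int[nu]_x (CA * h x)%:E)%E.
  rewrite -ge0_integralZl//=; last by rewrite lee_fin mulr_ge0// powR_ge0.
  rewrite -[RHS]ge0_integralZl//=.
  - rewrite integral_mkcond; apply: eq_integral => x _ /=.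
    rewrite patchE -!EFinM /h indicE; case: ifP => xD; last by rewrite !mulr0.
    by rewrite mulr1 mulrCA scaled_powR// mulrA.
  - by apply/measurable_EFinP; exact: measurable_funM.
  - by move=> x _; rewrite lee_fin mulr_ge0.
  - by rewrite lee_fin powR_ge0.
apply: lee_wpmul2l; first by rewrite lee_fin powR_ge0.
apply: product_measure_le_integral; first exact: measurable_near.
  by apply/measurable_EFinP; exact: measurable_funM.
move=> x; rewrite /h indicE; have [xD|xD] := boolP (x \in D); last first.
  rewrite (_ : xsection _ _ = set0) ?measure0 ?lee_fin ?mulr0//.
  rewrite -subset0 => y; rewrite /xsection /= inE => -[Dx _].
  by move/negP: xD; apply; rewrite inE.
rewrite mulr1; have /andP[_] := nu_rho x (powR_ge0 (c * `|u x| / lam) p).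
rewrite (_ : xsection _ _ = [set y | rho (x, y) <= (c * `|u x| / lam) `^ p])//.
apply/seteqP; split => y; rewrite /xsection /= inE; first by case.
by move=> ?; split => //; rewrite inE in xD.
Qed.

Lemma near_set_ge c lam D : 0 <= c -> 0 < lam -> measurable D ->
  ((Ca * c `^ p)%:E * \int[nu]_(x in D) (`|u x| `^ p)%:E <=
   (lam `^ p)%:E * (nu \x nu) (near_set c lam D))%E.
Proof.
move=> c0 lam0 mD.
set h := fun x => (c * `|u x| / lam) `^ p.
have h0 x : 0 <= h x by exact: powR_ge0.
have mh : measurable_fun setT h by exact: measurable_scaled.
have -> : ((Ca * c `^ p)%:E * \int[nu]_(x in D) (`|u x| `^ p)%:E =
    (lam `^ p)%:E * \int[nu]_(x in D) (Ca * h x)%:E)%E.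
  rewrite -ge0_integralZl//=; last by rewrite lee_fin mulr_ge0// powR_ge0.
  rewrite -[RHS]ge0_integralZl//=.
  - apply: eq_integral => x _ /=.
    by rewrite -!EFinM /h mulrCA scaled_powR// mulrA.
  - by apply: measurable_funTS; apply/measurable_EFinP; exact: measurable_funM.
  - by move=> x _; rewrite lee_fin mulr_ge0.
  - by rewrite lee_fin powR_ge0.
apply: lee_wpmul2l; first by rewrite lee_fin powR_ge0.
apply: le_integral_product_measure => //; first exact: measurable_near.
  by apply: measurable_funTS; apply/measurable_EFinP; exact: measurable_funM.
move=> x Dx; rewrite lee_fin mulr_ge0//=.
have /andP[+ _] := nu_rho x (h0 x).
rewrite (_ : xsection _ _ = [set y | rho (x, y) <= h x])//.
by apply/seteqP; split => y; rewrite /xsection /= inE; [case|split].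
Qed.

Let near_intro c lam (D : set T) z : 0 <= c -> 0 < lam -> rho_level lam z ->
  D z.1 -> `|u z.1 - u z.2| <= c * `|u z.1| -> near_set c lam D z.
Proof.
move=> c0 lam0 /rho_levelP -/(_ lam0) zl Dz cz; split => //.
apply: (le_trans zl); apply: ge0_ler_powR; rewrite ?nnegrE ?(ltW p0)//.
- by rewrite divr_ge0// ltW.
- by rewrite divr_ge0 ?mulr_ge0// ltW.
- by rewrite ler_pM2r// invr_gt0.
Qed.

Lemma rho_level_le lam : 0 < lam ->
  ((lam `^ p)%:E * (nu \x nu) (rho_level lam) <=
   (2 `^ (p + 1) * CA)%:E * \int[nu]_x (`|u x| `^ p)%:E)%E.
Proof.
move=> lam0; set K := near_set 2 lam setT.
have mK : measurable K by exact: measurable_near.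
have msK := measurable_preimage_swap mK.
have sub z : `|u z.2| <= `|u z.1| -> rho_level lam z -> K z.
  move=> u21 zl; apply: near_intro => //.
  by rewrite (le_trans (ler_normB _ _))// mulr_natl mulr2n lerD2l.
have muK : ((nu \x nu) (rho_level lam) <= 2%:E * (nu \x nu) K)%E.
  apply: (@le_trans _ _ ((nu \x nu) (K `|` swap_pair @^-1` K))%E).
    apply: le_product_measure; [exact: measurable_rho_level|exact: measurableU|].
    move=> z zl; have [u21|/ltW u12] := leP `|u z.2| `|u z.1|.
      by left; exact: sub.
    by right; apply: sub => //; move: zl; rewrite -{1}rho_level_swap.
  exact: le_product_measureU_swap.
apply: (@le_trans _ _ (2%:E * ((lam `^ p)%:E * (nu \x nu) K))%E).
  by rewrite muleCA lee_wpmul2l// lee_fin powR_ge0.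
apply: (@le_trans _ _ (2%:E * ((CA * 2 `^ p)%:E * \int[nu]_x (`|u x| `^ p)%:E))%E).
  by rewrite lee_wpmul2l// near_set_le.
(* The constant is [2 * 2 ^ p]: a factor 2 for the two orderings of a pair, and [c ^ p] with
   [c = 2]. *)
rewrite muleA -EFinM powRD; last by rewrite pnatr_eq0 implybT.
by rewrite powRr1// (mulrC CA) mulrCA mulrA.
Qed.

Lemma measurable_superlevel t : measurable [set x | t <= `|u x|].
Proof.
rewrite -[X in measurable X]setTI; apply: measurable_fun_le => //.
exact: measurableT_comp.
Qed.

Lemma measurable_sublevel t : measurable [set x | `|u x| < t].
Proof.
rewrite (_ : [set _ | _] = ~` [set x | t <= `|u x|]).
  by apply: measurableC; exact: measurable_superlevel.
by apply/seteqP; split => x /=; rewrite ltNge => /negP.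
Qed.

(* The pairs are split according to whether one of the two values is dominated
   by [e] times the other; only those that are not, and lie above height [eta],
   escape the sharp estimate, and they form a set of finite measure. *)
Lemma rho_level_le_sharp lam e eta : 0 < lam -> 0 < e -> 0 < eta ->
  ((lam `^ p)%:E * (nu \x nu) (rho_level lam) <=
   (2 * CA * (1 + e) `^ p)%:E * \int[nu]_x (`|u x| `^ p)%:E +
   (2 * CA * 2 `^ p)%:E * \int[nu]_(x in [set x | (`|u x| < eta)%R]) (`|u x| `^ p)%:E +
   (lam `^ p)%:E * (nu [set x | (e * eta <= `|u x|)%R] *
                    nu [set x | (e * eta <= `|u x|)%R]))%E.
Proof.
move=> lam0 e0 eta0; have mL := measurable_rho_level lam.
set K1 := near_set (1 + e) lam setT.
set K2 := near_set 2 lam [set x | `|u x| < eta].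
set S := [set x | e * eta <= `|u x|].
have mS : measurable S by exact: measurable_superlevel.
have mK1 : measurable K1 by exact: measurable_near.
have mK2 : measurable K2 by apply: measurable_near; exact: measurable_sublevel.
have mK : measurable (K1 `|` K2) by exact: measurableU.
have mSS : measurable (S `*` S) by exact: measurableX.
have sub z : `|u z.2| <= `|u z.1| -> rho_level lam z ->
    (K1 `|` K2) z \/ (S `*` S) z.
  move=> u21 zl; have [ue|ue] := leP `|u z.2| (e * `|u z.1|).
    left; left; apply: near_intro => //; first by rewrite addr_ge0// ltW.
    by rewrite (le_trans (ler_normB _ _))// mulrDl mul1r lerD2l.
  have [ueta|ueta] := ltP `|u z.1| eta.
    left; right; apply: near_intro => //.
    by rewrite (le_trans (ler_normB _ _))// mulr_natl mulr2n lerD2l.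
  (* Here [|u z.2| > e * |u z.1| >= e * eta], and [|u z.1|] is at least as large, so both
     coordinates lie in [S]. *)
  have z2S : S z.2 by rewrite /S /= (le_trans _ (ltW ue))// ler_pM2l.
  by right; split => //; exact: (le_trans z2S u21).
have muL : ((nu \x nu) (rho_level lam) <=
    2%:E * ((nu \x nu) K1 + (nu \x nu) K2) + nu S * nu S)%E.
  (* The square of [S] is its own swap, so it is counted once, outside the symmetrized union. *)
  apply: (@le_trans _ _ ((nu \x nu)
      (((K1 `|` K2) `|` swap_pair @^-1` (K1 `|` K2)) `|` S `*` S))%E).
    apply: le_product_measure => //.
      by do 2 apply: measurableU => //; exact: measurable_preimage_swap.
    move=> z zl; have [u21|/ltW u12] := leP `|u z.2| `|u z.1|.
      by have [?|?] := sub z u21 zl; [left; left|right].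
    have zsl : rho_level lam (swap_pair z) by move: zl; rewrite -{1}rho_level_swap.
    by have [?|[? ?]] := sub (swap_pair z) u12 zsl; [left; right|right].
  have mKK : measurable ((K1 `|` K2) `|` swap_pair @^-1` (K1 `|` K2)).
    by apply: measurableU => //; exact: measurable_preimage_swap.
  apply: (le_trans (@measureU2 _ _ _ (nu \x nu)%E _ _ mKK mSS)).
  apply: leeD; last by rewrite -product_measure1E.
  apply: le_trans (le_product_measureU_swap nu mK) _.
  by rewrite lee_wpmul2l//; exact: (@measureU2 _ _ _ (nu \x nu)%E _ _ mK1 mK2).
have lamp0 : (0 <= (lam `^ p)%:E)%E by rewrite lee_fin powR_ge0.
apply: (le_trans (lee_wpmul2l lamp0 muL)).
have k1 : (0 <= (nu \x nu) K1)%E by exact: (measure_ge0 (nu \x nu)%E).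
have k2 : (0 <= (nu \x nu) K2)%E by exact: (measure_ge0 (nu \x nu)%E).
have k12 := adde_ge0 k1 k2.
rewrite ge0_muleDr ?mule_ge0//.
rewrite leeD2r// muleCA (ge0_muleDr _ k1 k2).
rewrite (ge0_muleDr _ (mule_ge0 lamp0 k1) (mule_ge0 lamp0 k2)).
rewrite -!(mulrA 2) !(EFinM 2) -!muleA.
apply: leeD; apply: lee_wpmul2l => //; apply: near_set_le => //.
- by rewrite addr_ge0// ltW.
- exact: measurable_sublevel.
Qed.

(* Only pairs with one value above [eta] and the other below [e * eta] are
   used; they occur in two disjoint, symmetric copies, whence the factor 2. *)
Lemma rho_level_ge_sharp lam e eta : 0 < lam -> 0 < e < 1 -> 0 < eta ->
  ((2 * Ca * (1 - e) `^ p)%:E *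
     \int[nu]_(x in [set x | (eta <= `|u x|)%R]) (`|u x| `^ p)%:E <=
   (lam `^ p)%:E * (nu \x nu) (rho_level lam) +
   2%:E * ((lam `^ p)%:E * (nu [set x | (e * eta <= `|u x|)%R] *
                    nu [set x | (e * eta <= `|u x|)%R])))%E.
Proof.
move=> lam0 /andP[e0 e1] eta0; have mL := measurable_rho_level lam.
set D := [set x | eta <= `|u x|]; set S := [set x | e * eta <= `|u x|].
have mS : measurable S by exact: measurable_superlevel.
have mD : measurable D by exact: measurable_superlevel.
have DS : D `<=` S.
  by move=> x; rewrite /D /S /=; apply: le_trans; rewrite ger_pMl// ltW.
set K := near_set (1 - e) lam D.
have mK : measurable K by exact: measurable_near.
set P := K `&` (setT `*` ~` S).
have mP : measurable P.
  by apply: measurableI => //; apply: measurableX => //; exact: measurableC.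
have mSS : measurable (S `*` S) by exact: measurableX.
(* As [D] is contained in [S], the pairs of [K] lost in [P] all lie in the square of [S]. *)
have KP : ((nu \x nu) K <= (nu \x nu) P + nu S * nu S)%E.
  rewrite -product_measure1E//.
  apply: le_trans (@measureU2 _ _ _ (nu \x nu)%E _ _ mP mSS).
  apply: le_product_measure => //; first exact: measurableU.
  move=> z Kz; have [Sz2|Sz2] := pselect (S z.2); last by left.
  by right; split => //; apply: DS; case: Kz.
(* On [P], [|u y| < e * eta <= e * |u x|], hence [|u x - u y| >= (1 - e) * |u x|]; moreover
   [x <> y], as only [x] lies in [S]. *)
have PL : P `<=` rho_level lam.
  move=> [x y] [[/= Dx xy] [_ /= Sy]]; apply: (le_rho_level lam0 _ _ xy).
    by move=> xy'; apply: Sy; rewrite -xy'; exact: DS.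
  rewrite mulr_ge0 ?subr_ge0 ?(ltW e1)//=.
  apply: (le_trans _ (lerB_normD _ _)) => /=.
  rewrite normrN mulrBl mul1r lerD2l lerN2.
  move/negP: Sy; rewrite /S /= -ltNge => /ltW /le_trans; apply.
  by rewrite ler_pM2l.
(* A common point would have its first coordinate both in [D], hence in [S], and outside [S]. *)
have PP : [disjoint P & swap_pair @^-1` P].
  apply/disj_set2P; rewrite -subset0 => z [[[Dz _] _] [_ [_ nS]]].
  by apply: nS; exact: DS.
have muP : (2%:E * (nu \x nu) P <= (nu \x nu) (rho_level lam))%E.
  rewrite -product_measureU_swap//; apply: le_product_measure => //.
    by apply: measurableU => //; exact: measurable_preimage_swap.
  by move=> z [/PL//|/PL]; rewrite -{2}rho_level_swap.
have lamp0 : (0 <= (lam `^ p)%:E)%E by rewrite lee_fin powR_ge0.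
apply: (@le_trans _ _ (2%:E * ((lam `^ p)%:E * (nu \x nu) K))%E).
  rewrite -mulrA EFinM -muleA lee_wpmul2l// near_set_ge//.
  by rewrite subr_ge0 ltW.
apply: (@le_trans _ _ (2%:E * ((lam `^ p)%:E * ((nu \x nu) P + nu S * nu S)))%E).
  by rewrite lee_wpmul2l// lee_wpmul2l.
rewrite ge0_muleDr ?mule_ge0// ge0_muleDr ?mule_ge0//.
by rewrite leeD2r// muleCA lee_wpmul2l.
Qed.

End level_sets.

(** * Criteria for limits superior and inferior along a filter *)

Section limf.
Context {R : realType} {T : choiceType} {I : filteredType T}.
Implicit Types (phi : I -> \bar R) (F : set_system I).
Local Open Scope ereal_scope.

(** The limsup is an infimum of suprema over sets of the filter; the set where the bound holds is
    one of the competitors. *)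
Lemma limf_esup_le phi F (l : \bar R) : Filter F ->
  (forall e : R, (0 < e)%R -> \forall x \near F, phi x <= l + e%:E) ->
  limf_esup phi F <= l.
Proof.
move=> FF h; apply/lee_addgt0Pr => e e0; apply: ge_ereal_inf.
exists (ereal_sup (phi @` [set x | phi x <= l + e%:E])).
  by exists [set x | phi x <= l + e%:E] => //; exact: h.
by apply: ge_ereal_sup => _ [x /= ? <-].
Qed.

Lemma le_limf_einf phi F (l : \bar R) : Filter F ->
  (forall e : R, (0 < e)%R -> \forall x \near F, l <= phi x + e%:E) ->
  l <= limf_einf phi F.
Proof.
move=> FF h; apply/lee_addgt0Pr => e e0; rewrite -leeBlDr// limf_einfE.
apply: le_ereal_sup_tmp.
exists (ereal_inf (phi @` [set x | l <= phi x + e%:E])).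
  by exists [set x | l <= phi x + e%:E] => //; exact: h.
by apply/ereal_infP => _ [x /= ? <-]; rewrite EFinN leeBlDr.
Qed.

(** Two sets of a proper filter share a point, whose value separates the infimum over one from the
    supremum over the other. *)
Lemma limf_einf_le_esup phi F : ProperFilter F ->
  limf_einf phi F <= limf_esup phi F.
Proof.
move=> FF; rewrite limf_einfE; apply: ge_ereal_sup => _ [V FV <-].
apply: le_ereal_inf_tmp => _ [W FW <-].
have [x [Vx Wx]] := filter_ex (filterI FV FW).
apply: (@le_trans _ _ (phi x)).
  by apply: ge_ereal_inf; exists (phi x) => //; exists x.
by apply: le_ereal_sup_tmp; exists (phi x) => //; exists x.
Qed.

(** With [D] the positive reals, this passes from the liminf to the weak quantity. *)
Lemma limf_einf_le_sup phi F (D : set I) : ProperFilter F -> F D ->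
  limf_einf phi F <= ereal_sup (phi @` D).
Proof.
move=> FF FD; apply: (le_trans (limf_einf_le_esup phi FF)).
by apply: ge_ereal_inf; exists (ereal_sup (phi @` D)) => //; exists D.
Qed.

End limf.

(** * Superlevel and sublevel sets of a function in [L^p] *)

Section small_levels.
Context d (T : measurableType d) (R : realType).
Variable nu : {measure set T -> \bar R}.
Variables (p : R) (u : T -> R).
Hypothesis p0 : 0 < p.
Hypothesis mu : measurable_fun setT u.
Local Open Scope ereal_scope.
Hypothesis intu : \int[nu]_x (`|u x| `^ p)%:E < +oo.

Let measurable_upow (D : set T) : measurable_fun D (fun x => (`|u x| `^ p)%:E).
Proof.
apply: measurable_funTS; apply/measurable_EFinP.
by apply: measurableT_comp (measurable_powR _) _; exact: measurableT_comp.
Qed.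

(** Chebyshev's inequality: [t ^ p * nu D] is at most the integral of [|u| ^ p]. *)
Lemma superlevel_lty (t : R) : (0 < t)%R ->
  nu [set x | (t <= `|u x|)%R] < +oo.
Proof.
move=> t0; set D := [set x | _].
have mD : measurable D by exact: measurable_superlevel.
have tp0 : (0 < t `^ p)%R by rewrite powR_gt0.
have : (t `^ p)%:E * nu D < +oo.
  apply: le_lt_trans intu; rewrite -integral_cst//.
  apply: (@le_trans _ _ (\int[nu]_(x in D) (`|u x| `^ p)%:E)).
    apply: ge0_le_integral => //.
    - by move=> x _; rewrite lee_fin ltW.
    - move=> x Dx; rewrite lee_fin; apply: ge0_ler_powR; rewrite ?nnegrE//.
      + exact: ltW.
      + exact: ltW.
  by apply: ge0_subset_integral => // x _; rewrite lee_fin powR_ge0.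
have := measure_ge0 nu D; case: (nu D) => // [r _ _|_]; first exact: ltry.
by rewrite mulry gtr0_sg// mul1e.
Qed.

(** Dominated convergence for the restrictions of [|u| ^ p] to [|u| < 1 / (n + 1)]. *)
Lemma integral_sublevel_small (e : R) : (0 < e)%R -> exists2 t : R, (0 < t)%R &
  \int[nu]_(x in [set x | (`|u x| < t)%R]) (`|u x| `^ p)%:E <= e%:E.
Proof.
move=> e0.
pose S n := [set x | (`|u x| < n.+1%:R^-1)%R].
have mS n : measurable (S n) by exact: measurable_sublevel.
pose g x := (`|u x| `^ p)%:E.
have g0 x : 0 <= g x by rewrite lee_fin powR_ge0.
have mg : measurable_fun setT g by exact: measurable_upow.
pose f_ n := g \_ (S n).
have fg n x : `|f_ n x| <= g x.
  by rewrite /f_ patchE; case: ifP => _; rewrite ?gee0_abs// abse0.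
have [] := @dominated_convergence _ _ _ nu setT measurableT f_ (cst 0) g.
- by move=> n; apply/(measurable_restrictT _ _).1 => //; exact: measurable_funTS.
- by [].
- apply: aeW => x _; apply: cvg_near_cst.
  (* A zero of [u] stays in every [S n], but the integrand is 0 there since [p > 0]; any other point
     eventually leaves [S n]. *)
  have [ux|ux] := eqVneq (u x) 0%R.
    by apply: nearW => n; rewrite /f_ patchE /g ux normr0 powR0 ?gt_eqF// if_same.
  have ux0 : (0 < `|u x|)%R by rewrite normr_gt0.
  have [N _ NS] := (@cvgr_lt _ _ _ _ _ _ (@cvg_harmonic R)) _ ux0.
  exists N => // n /NS /= h; rewrite /f_ patchE ifF//; apply/negbTE/negP.
  by rewrite inE /S /= ltNge => /negP; apply; exact: ltW.
- by apply/integrableP; split => //; under eq_integral do rewrite gee0_abs//.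
- by apply: aeW => x n _; exact: fg.
move=> _ _; rewrite integral0 => /fine_cvgP[fin /cvgr_lt/(_ _ e0) lt_e].
have [n [/= fn ltn]] := filter_ex (filterI fin lt_e).
exists n.+1%:R^-1%R; first by rewrite invr_gt0.
by rewrite integral_mkcond -(fineK fn) lee_fin ltW.
Qed.

End small_levels.

(** Continuity of the power at 1, made explicit: [s] is chosen so that [(1 + s) ^ p], respectively
    [(1 - s) ^ p], equals a prescribed [c] close to 1. *)
Lemma powR_mul_close (R : realType) (p K e : R) : 0 < p -> 0 <= K -> 0 < e ->
  (exists2 s : R, 0 < s & K * (1 + s) `^ p <= K + e) /\
  (exists2 s : R, 0 < s < 1 & K <= K * (1 - s) `^ p + e).
Proof.
move=> p0 K0 e0; have pn0 := lt0r_neq0 p0.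
have ip0 : 0 < p^-1 by rewrite invr_gt0.
have pow1 (q : R) : 1 = 1 `^ q by rewrite powR1.
split.
- pose c := 1 + e / (K + 1).
  have c1 : 1 < c by rewrite ltrDl divr_gt0// ltr_wpDl.
  exists (c `^ p^-1 - 1).
    by rewrite subr_gt0 {1}(pow1 p^-1) gt0_ltr_powR// nnegrE// ltW// (lt_trans _ c1).
  rewrite addrC subrK -powRrM mulVf// powRr1; last by rewrite ltW// (lt_trans _ c1).
  rewrite mulrDr mulr1 lerD2l mulrA ler_pdivrMr ?ltr_wpDl// mulrDr mulr1 mulrC.
  by rewrite lerDl ltW.
(* The [e] in the denominator keeps [c] positive, and [K * e / (K + e + 1) <= e]. *)
- pose c := 1 - e / (K + e + 1).
  have c1 : c < 1 by rewrite gtrDl oppr_lt0 divr_gt0// ltr_wpDl// addr_ge0// ltW.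
  have Ke : 0 < K + e + 1 by rewrite ltr_wpDl// addr_ge0// ltW.
  have c0 : 0 < c by rewrite subr_gt0 ltr_pdivrMr// mul1r; lra.
  exists (1 - c `^ p^-1).
    rewrite subr_gt0 gtrBl powR_gt0// andbT [ltRHS](pow1 p^-1).
    by rewrite gt0_ltr_powR// nnegrE ltW.
  rewrite subKr -powRrM mulVf// powRr1; last exact: ltW.
  rewrite mulrBr mulr1 -addrA lerDl addrC subr_ge0 mulrA ler_pdivrMr//.
  by rewrite mulrC ler_pM2l//; lra.
Qed.

(** * Behaviour of the weighted level sets as [lam] tends to 0 *)

Section asymptotics.
Context d (T : measurableType d) (R : realType).
Variable nu : {sigma_finite_measure set T -> \bar R}.
Variables (rho : T * T -> R) (Ca CA : R).
Hypothesis mrho : measurable_fun setT rho.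
Hypothesis rho_ge0 : forall z, 0 <= rho z.
Hypothesis rho_gt0 : forall x y, x <> y -> 0 < rho (x, y).
Hypothesis rhoC : forall x y, rho (x, y) = rho (y, x).
Hypothesis Ca_ge0 : 0 <= Ca.
Hypothesis CA_ge0 : 0 <= CA.
Hypothesis nu_rho : forall x t, 0 <= t ->
  ((Ca * t)%:E <= nu [set y | (rho (x, y) <= t)%R] <= (CA * t)%:E)%E.
Variables (p : R) (u : T -> R).
Hypothesis p1 : 1 <= p.
Hypothesis mu : measurable_fun setT u.
Local Open Scope ereal_scope.
Let N := \int[nu]_x (`|u x| `^ p)%:E.
Hypothesis intu : N < +oo.

Let p0 : (0 < p)%R. Proof. by rewrite (lt_le_trans _ p1). Qed.

Let phi lam := (lam `^ p)%:E * (nu \x nu) (rho_level rho p u lam).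

Let N_ge0 : 0 <= N.
Proof. by apply: integral_ge0 => x _; rewrite lee_fin powR_ge0. Qed.

Let N_fin : N = (fine N)%:E.
Proof. by rewrite fineK// ge0_fin_numE. Qed.

Let fN_ge0 : (0 <= fine N)%R. Proof. exact: fine_ge0. Qed.

Let integral_ge0' D : 0 <= \int[nu]_(x in D) (`|u x| `^ p)%:E.
Proof. by apply: integral_ge0 => x _; rewrite lee_fin powR_ge0. Qed.

(** Disposes of the remainder of finite measure: [lam <= (e / (M + 1)) ^ (1 / p)] suffices. *)
Let near_powR_le (M : \bar R) (e : R) : 0 <= M -> M < +oo -> (0 < e)%R ->
  \forall lam \near 0^'+, (0 < lam)%R /\ (lam `^ p)%:E * M <= e%:E.
Proof.
move=> M0 Moo e0; rewrite -(fineK (_ : M \is a fin_num)) ?ge0_fin_numE//.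
have fM : (0 < fine M + 1)%R by rewrite ltr_wpDl// fine_ge0.
pose c := (e / (fine M + 1))%R; have c0 : (0 < c)%R by rewrite divr_gt0.
have cp0 : (0 < c `^ p^-1)%R by rewrite powR_gt0.
near=> lam; have lam0 : (0 < lam)%R by [].
split => //; rewrite -EFinM lee_fin.
apply: (@le_trans _ _ (c * (fine M + 1))%R); last first.
  by rewrite divfK// gt_eqF.
apply: ler_pM; rewrite ?powR_ge0 ?fine_ge0 ?lerDl//.
rewrite -[leRHS](powRr1 (ltW c0)) -(mulVf (lt0r_neq0 p0)) powRrM.
by apply: ge0_ler_powR => //; rewrite ?nnegrE ?powR_ge0// ltW.
Unshelve. all: by end_near. Qed.

Lemma limf_esup_rho_level : limf_esup phi 0^'+ <= (2 * CA)%:E * N.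
Proof.
(* One third of [e] each for the factor [(1 + s) ^ p], the integral below height [eta], and the
   remainder. The order is [s], then [eta], then [lam], because [M] depends on the first two. *)
apply: limf_esup_le => e e0; have e3 : (0 < e / 3)%R by rewrite divr_gt0.
have K0 : (0 <= 2 * CA * fine N)%R by rewrite !mulr_ge0.
have [[s s0 Ks] _] := powR_mul_close p0 K0 e3.
have K2 : (0 <= 2 * CA * 2 `^ p)%R by rewrite !mulr_ge0// powR_ge0.
have e3' : (0 < e / 3 / (2 * CA * 2 `^ p + 1))%R by rewrite divr_gt0// ltr_wpDl.
have [eta eta0 small] := integral_sublevel_small p0 mu intu e3'.
have seta : (0 < s * eta)%R by rewrite mulr_gt0.
set M := nu [set x | (s * eta <= `|u x|)%R].
have Moo : M < +oo := superlevel_lty p0 mu intu seta.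
have M0 : 0 <= M by exact: measure_ge0.
have MMoo : M * M < +oo by apply: lte_mul_pinfty => //; rewrite ge0_fin_numE.
apply: filterS (near_powR_le (mule_ge0 M0 M0) MMoo e3) => // lam [lam0 lamM].
apply: (le_trans (rho_level_le_sharp mrho rho_ge0 rhoC CA_ge0 nu_rho p1 mu
  lam0 s0 eta0)).
have -> : (2 * CA)%:E * N + e%:E =
    ((2 * CA)%:E * N + (e / 3)%:E) + (e / 3)%:E + (e / 3)%:E.
  by rewrite -!addeA -!EFinD; congr (_ + _%:E); field.
apply: leeD => //; apply: leeD.
  rewrite -/N N_fin -!EFinM -EFinD lee_fin.
  by rewrite -[X in (X <= _)%R]mulrA [X in (_ * X <= _)%R]mulrC mulrA.
apply: (@le_trans _ _ ((2 * CA * 2 `^ p)%:E * (e / 3 / (2 * CA * 2 `^ p + 1))%:E)).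
  by rewrite lee_wpmul2l.
rewrite -EFinM lee_fin mulrA ler_pdivrMr ?ltr_wpDl//.
by rewrite mulrC ler_pM2l// lerDl.
Qed.

Lemma limf_einf_rho_level : (2 * Ca)%:E * N <= limf_einf phi 0^'+.
Proof.
apply: le_limf_einf => e e0; have e3 : (0 < e / 3)%R by rewrite divr_gt0.
have K0 : (0 <= 2 * Ca * fine N)%R by rewrite !mulr_ge0.
have [_ [s s01 Ks]] := powR_mul_close p0 K0 e3.
have /andP[s0 s1] := s01.
have K2 : (0 <= 2 * Ca)%R by rewrite !mulr_ge0.
have e3' : (0 < e / 3 / (2 * Ca + 1))%R by rewrite divr_gt0// ltr_wpDl.
have [eta eta0 small] := integral_sublevel_small p0 mu intu e3'.
have seta : (0 < s * eta)%R by rewrite mulr_gt0.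
set M := nu [set x | (s * eta <= `|u x|)%R].
have Moo : M < +oo := superlevel_lty p0 mu intu seta.
have M0 : 0 <= M by exact: measure_ge0.
have MMoo : M * M < +oo by apply: lte_mul_pinfty => //; rewrite ge0_fin_numE.
(* Halved because the remainder enters [rho_level_ge_sharp] with a factor 2. *)
have e6 : (0 < e / 3 / 2)%R by rewrite divr_gt0.
apply: filterS (near_powR_le (mule_ge0 M0 M0) MMoo e6) => // lam [lam0 lamM].
have := rho_level_ge_sharp mrho rho_ge0 rho_gt0 rhoC Ca_ge0 nu_rho p1 mu
  lam0 s01 eta0.
set A := \int[nu]_(x in _) _; set B := \int[nu]_(x in _) _ in small.
rewrite -/M => sharp.
(* The sharp estimate controls only [A], the part above [eta]; [B] is small by the choice of [eta],
   its coefficient being at most [2 * Ca]. *)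
have NAB : N = A + B.
  rewrite /N /A /B -ge0_integral_setU//.
  - congr (integral _ _ _); apply/seteqP; split => // x _ /=.
    by have [?|?] := leP eta `|u x|%R; [left|right].
  - exact: measurable_superlevel.
  - exact: measurable_sublevel.
  - apply/measurable_EFinP; apply: measurable_funTS.
    by apply: measurableT_comp (measurable_powR _) _; exact: measurableT_comp.
  - apply/disj_set2P; rewrite -subset0 => x [/= ? /lt_geF].
    by move=> /negbT/negP; apply.
have c1 : ((1 - s) `^ p <= 1)%R.
  rewrite [leRHS](_ : _ = (1 `^ p)%R); last by rewrite powR1.
  apply: ge0_ler_powR; rewrite ?nnegrE ?(ltW p0)//.
    by rewrite subr_ge0 ltW.
  by rewrite gerBl ltW.
have -> : phi lam + e%:E = (phi lam + (e / 3)%:E) + (e / 3)%:E + (e / 3)%:E.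
  by rewrite -!addeA -!EFinD; congr (_ + _%:E); field.
apply: (@le_trans _ _ ((2 * Ca * (1 - s) `^ p)%:E * N + (e / 3)%:E)).
  rewrite N_fin -!EFinM -EFinD lee_fin.
  by rewrite -[X in (_ <= X + _)%R]mulrA [X in (_ <= _ * X + _)%R]mulrC mulrA.
apply: leeD => //; rewrite NAB ge0_muleDr; [|exact: integral_ge0'|exact: integral_ge0'].
apply: leeD.
  apply: (le_trans sharp); apply: leeD => //.
  apply: (@le_trans _ _ (2%:E * (e / 3 / 2)%:E)); first by rewrite lee_wpmul2l.
  by rewrite -EFinM lee_fin mulrC divfK.
apply: (@le_trans _ _ ((2 * Ca)%:E * (e / 3 / (2 * Ca + 1))%:E)).
  apply: (@le_trans _ _ ((2 * Ca)%:E * B)); last by rewrite lee_wpmul2l.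
  by rewrite lee_wpmul2r ?integral_ge0'// lee_fin ler_piMr.
rewrite -EFinM lee_fin mulrA ler_pdivrMr ?ltr_wpDl//.
by rewrite mulrC ler_pM2l// lerDl.
Qed.

End asymptotics.

(** * Continuity and surjectivity of a convex increasing gauge on the half-line *)

Section convex_gauge.
Context (R : realType) (f : R -> R).
Hypothesis f_ge0 : forall r : R, 0 <= r -> 0 <= f r.
Hypothesis f_convex : convex_function (`[0, +oo[%classic : set R) f.
Hypothesis f_incr : forall r s : R, 0 <= r -> r < s -> f r < f s.
Hypothesis f0 : f 0 = 0.

Let f_convexE (t x y : R) : 0 <= t <= 1 -> 0 <= x -> 0 <= y ->
  f (t * x + (1 - t) * y) <= t * f x + (1 - t) * f y.
Proof.
move=> /andP[t0 t1] x0 y0.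
have itv0 (z : R) : 0 <= z -> z \in (`[0, +oo[%classic : set R).
  by move=> z0; rewrite inE /= in_itv/= z0.
exact: (f_convex (Itv01 t0 t1) (itv0 x x0) (itv0 y y0)).
Qed.

Lemma incr_ltr_mono r s : 0 <= r -> 0 <= s -> (f r < f s) = (r < s).
Proof.
move=> r0 s0; have [rs|sr|->] := ltgtP r s; last by rewrite ltxx.
- exact: f_incr.
- by apply/negbTE; rewrite -leNgt ltW// f_incr.
Qed.

(** Convexity between [0] and [M], at [1 = M^-1 * M + (1 - M^-1) * 0], with [f 0 = 0]. *)
Lemma convex_gauge_linear_growth M : 1 <= M -> M * f 1 <= f M.
Proof.
move=> M1; have M0 : 0 < M by rewrite (lt_le_trans _ M1).
rewrite mulrC -ler_pdivlMr//.
have := @f_convexE M^-1 M 0 _ (ltW M0) (lexx _).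
rewrite mulVf ?gt_eqF// mulr0 addr0 f0 mulr0 addr0 mulrC; apply.
by rewrite invr_ge0 ltW//= invf_le1.
Qed.

(** [b] divides the segment from [a] to [M + 1] in ratio [t]. Going 1 beyond [M] makes that segment
    at least 1 long, so [t <= b - a]. *)
Lemma convex_gauge_lipschitz M a b : 0 <= a <= b -> b <= M ->
  f b - f a <= (b - a) * f (M + 1).
Proof.
move=> /andP[a0 ab] bM; have D0 : 0 < M + 1 - a by lra.
have D1 : 1 <= M + 1 - a by lra.
have M1 : 0 <= M + 1 by lra.
pose t := (b - a) / (M + 1 - a).
have t0 : 0 <= t by apply: divr_ge0; [rewrite subr_ge0|exact: ltW].
have tD : t <= b - a by rewrite ler_pdivrMr// ler_peMr// subr_ge0.
have t01 : 0 <= t <= 1 by rewrite t0 /= ler_pdivrMr//; lra.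
have := f_convexE t01 M1 a0.
have -> : t * (M + 1) + (1 - t) * a = b.
  by rewrite /t; field; exact: lt0r_neq0.
move=> h; apply: (@le_trans _ _ (t * f (M + 1))); last first.
  by rewrite ler_wpM2r// f_ge0.
have := mulr_ge0 t0 (f_ge0 a0); lra.
Qed.

(** The Lipschitz bound and monotonicity cover the endpoint 0 too, where convexity alone would allow
    a jump. *)
Lemma convex_gauge_continuous M : {within `[0, M], continuous f}.
Proof.
apply/subspace_continuousP => x; rewrite /= in_itv/= => /andP[x0 xM].
apply/cvgrPdist_le => e e0; rewrite near_withinE.
have L0 : 0 < f (M + 1) by rewrite -f0 f_incr//; lra.
have dL : 0 < e / f (M + 1) by rewrite divr_gt0.
have idx : y @[y --> x] --> x by exact: cvg_id.
near=> y; rewrite /= in_itv/= => /andP[y0 yM].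
have xy : `|x - y| <= e / f (M + 1).
  by near: y; move/cvgrPdist_le : idx; exact.
apply: (@le_trans _ _ (`|x - y| * f (M + 1))); last by rewrite -ler_pdivlMr.
have [xley|/ltW ylex] := leP x y.
  rewrite distrC ger0_norm; last by rewrite subr_ge0 leNgt incr_ltr_mono// -leNgt.
  rewrite distrC ger0_norm ?subr_ge0//.
  by apply: convex_gauge_lipschitz => //; rewrite x0.
rewrite ger0_norm; last by rewrite subr_ge0 leNgt incr_ltr_mono// -leNgt.
rewrite ger0_norm ?subr_ge0//.
by apply: convex_gauge_lipschitz => //; rewrite y0.
Unshelve. all: by end_near. Qed.

Lemma convex_gauge_surj t : 0 <= t -> exists2 r, 0 <= r & f r = t.
Proof.
move=> t0; have f1 : 0 < f 1 by rewrite -f0 f_incr.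
(* Linear growth gives [f M >= M * f 1 >= t], so the intermediate value theorem applies on
   [[0, M]]. *)
pose M := Num.max 1 (t / f 1).
have M1 : 1 <= M by rewrite le_max lexx.
have M0 : 0 <= M by rewrite (le_trans _ M1).
have tM : t <= f M.
  apply: (le_trans _ (convex_gauge_linear_growth M1)).
  by rewrite -ler_pdivrMr// le_max lexx orbT.
have [|r] := @IVT _ f 0 M t M0 (@convex_gauge_continuous M).
  by rewrite f0 (min_idPl _) ?(max_idPr _) ?f_ge0// t0.
by rewrite in_itv/= => /andP[r0 _] <-; exists r.
Qed.

End convex_gauge.

(** * Measurability of the distance for the product sigma-algebra *)

Section metric_measurability.
Context (R : realType) (X : completeMetricType R).

Lemma open_ball (x : X) (r : R) : open (ball x r).
Proof.
rewrite openE => y; rewrite ballEmdist /= => xy.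
rewrite /interior -nbhs_ballE /nbhs_ball/=.
exists (r - mdist x y); first by rewrite /= subr_gt0.
move=> z; rewrite ballEmdist/= => yz; have := metric_triangle x y z; lra.
Qed.

Lemma measurable_ball_borel (x : X) (r : R) :
  measurable (ball x r : set (borel X)).
Proof. by apply: sub_sigma_algebra; exact: open_ball. Qed.

(** The product sigma-algebra is generated by rectangles; separability writes [d < r] as a countable
    union of products of balls with a common center in the dense set. *)
Lemma measurable_mdist : separable X ->
  measurable_fun setT (fun z : borel X * borel X => mdist (z.1 : X) (z.2 : X)).
Proof.
move=> [D Dc dD] _.
apply: (measurability _ (RGenInftyO.measurableE R)) => //.
move=> /= _ [_ [r ->] <-]; rewrite setTI.
rewrite (_ : _ @^-1` _ = \bigcup_n \bigcup_(q : D)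
    ((ball (val q) n.+1%:R^-1 : set (borel X)) `*`
     (ball (val q) (r - n.+1%:R^-1) : set (borel X)))).
  apply: bigcup_measurable => n _; apply: countable_bigcupT_measurable.
    by rewrite (eq_countable (card_setT D)).
  by move=> q; apply: measurableX; exact: measurable_ball_borel.
apply/seteqP; split => -[x y].
  rewrite /= in_itv/= => xyr.
  (* With [1 / (N + 1)] below half the gap, [d q y < 1 / (N + 1) + d x y < r - 1 / (N + 1)]. *)
  have d0 : 0 < (r - mdist (x : X) (y : X)) / 2 by rewrite divr_gt0// subr_gt0.
  have [N _ hN] := (@cvgr_lt _ _ _ _ _ _ (@cvg_harmonic R)) _ d0.
  have {hN} := hN N (leqnn N); rewrite /harmonic /= => nd.
  have n0 : 0 < N.+1%:R^-1 :> R by rewrite invr_gt0.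
  have [q [qx Dq]] : ball (x : X) N.+1%:R^-1 `&` D !=set0.
    by apply: dD; [exists x; exact: ballxx|exact: open_ball].
  exists N => //; exists (SigSub (mem_set Dq)) => //=; split => /=.
    exact: ball_sym.
  rewrite ballEmdist /=; move: qx; rewrite ballEmdist /= metric_sym => qx.
  have := metric_triangle q (x : X) (y : X).
  move: n0 nd qx; set h := _^-1; set a := mdist _ _; lra.
move=> [n _ [q _]] [] /=; rewrite !ballEmdist /= in_itv/= => qx qy.
apply: le_lt_trans (metric_triangle (x : X) (val q : X) (y : X)) _.
by rewrite (metric_sym (x : X)) (lt_le_trans (ltrD qx qy))// subrKC.
Qed.

End metric_measurability.

(** * Consequences of Ahlfors regularity for the gauge [f (d (x, y))] *)

Section ahlfors.
Context (R : realType) (X : completeMetricType R).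
Variable nu : {measure set (borel X) -> \bar R}.
Variables (f : R -> R) (Ca CA : R).
Hypothesis sepX : separable X.
Hypothesis f_ge0 : forall r : R, 0 <= r -> 0 <= f r.
Hypothesis f_convex : convex_function (`[0, +oo[%classic : set R) f.
Hypothesis f_incr : forall r s : R, 0 <= r -> r < s -> f r < f s.
Hypothesis f0 : f 0 = 0.
Hypothesis CA_gt0 : 0 < CA.
Hypothesis hreg : ahlfors_regular nu f Ca CA.

Let rho (z : borel X * borel X) := f (mdist (z.1 : X) (z.2 : X)).

Lemma ahlfors_sigma_finite : sigma_finite setT nu.
Proof.
exists (fun n => ball (point : X) n.+1%:R).
  apply/seteqP; split => // x _.
  exists (Num.truncn (mdist (point : X) (x : X))) => //.
  by rewrite ballEmdist /= truncnS_gt.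
move=> n; split; first exact: measurable_ball_borel.
have /andP[_ /le_lt_trans] := @hreg point n.+1%:R (ltr0Sn _ _).
by apply; exact: ltry.
Qed.

(** [f] is arbitrary on negative reals, so instead of composing, the condition [rho < t] with
    [t > 0] is turned into [d < r] where [f r = t]. *)
Lemma measurable_gauge_dist : measurable_fun setT rho.
Proof.
move=> _; apply: (measurability _ (RGenInftyO.measurableE R)) => //.
move=> /= _ [_ [t ->] <-]; rewrite setTI.
have [t0|t0] := leP t 0.
  rewrite (_ : _ @^-1` _ = set0); first exact: measurable0.
  rewrite -subset0 => z; rewrite /= in_itv/= ltNge => /negP; apply.
  by rewrite (le_trans t0)// f_ge0// mdist_ge0.
have [r r0 fr] := convex_gauge_surj f_ge0 f_convex f_incr f0 (ltW t0).
rewrite (_ : _ @^-1` _ = setT `&` (fun z : borel X * borel X =>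
    mdist (z.1 : X) (z.2 : X)) @^-1` `]-oo, r[%classic).
  by apply: measurable_mdist => //; exact: measurable_itv.
rewrite setTI; apply/seteqP; split => z; rewrite /= !in_itv/= /rho -fr.
  by rewrite incr_ltr_mono ?mdist_ge0.
by rewrite incr_ltr_mono ?mdist_ge0.
Qed.

(** Regularity concerns open balls, while the sublevel set is a closed one: it contains the open
    ball of radius [r] and lies in slightly larger ones. *)
Lemma ahlfors_gauge_ball (x : borel X) t : 0 <= t ->
  ((Ca * t)%:E <= nu [set y | (rho (x, y) <= t)%R] <= (CA * t)%:E)%E.
Proof.
move=> t0; have [r r0 fr] := convex_gauge_surj f_ge0 f_convex f_incr f0 t0.
have rhoE : [set y | rho (x, y) <= t] = [set y | mdist (x : X) (y : X) <= r].
  by apply/seteqP; split => y; rewrite /rho /= -fr !leNgt incr_ltr_mono ?mdist_ge0.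
have mrho : measurable [set y | rho (x, y) <= t].
  rewrite -[X in measurable X]setTI; apply: measurable_fun_le => //.
  exact: (measurableT_comp measurable_gauge_dist (measurable_pair1 _)).
apply/andP; split.
  have [r00|rn0] := eqVneq r 0; first by rewrite -fr r00 f0 mulr0 measure_ge0.
  have rgt0 : 0 < r by rewrite lt0r rn0.
  have /andP[+ _] := hreg (x : X) rgt0; rewrite fr => /le_trans; apply.
  apply: le_measure; rewrite ?inE//; first exact: measurable_ball_borel.
  by rewrite rhoE ballEmdist => y /ltW.
apply/lee_addgt0Pr => e e0.
(* Enlarging [t] by [e / CA] costs exactly [e] after multiplication by [CA]. *)
have s0 : 0 <= t + e / CA by rewrite addr_ge0// divr_ge0// ltW.
have [s s_ge0 fs] := convex_gauge_surj f_ge0 f_convex f_incr f0 s0.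
have rs : r < s by rewrite -(incr_ltr_mono f_incr)// fr fs ltrDl divr_gt0.
have s_gt0 : 0 < s by rewrite (le_lt_trans r0).
have /andP[_] := hreg (x : X) s_gt0.
rewrite fs mulrDr mulrCA divff ?gt_eqF// mulr1.
apply: le_trans; apply: le_measure; rewrite ?inE//.
  exact: measurable_ball_borel.
by rewrite rhoE ballEmdist => y /= /le_lt_trans; apply.
Qed.

End ahlfors.

Section sigma_finite_bundle.
Context d (T : measurableType d) (R : realType).
Context (nu : {measure set T -> \bar R}).

(** An alias of [nu] that carries the proof [sf], so that the sigma-finite structure can be attached
    to it; it converts to [nu], so results transfer verbatim. *)
Definition as_sigma_finite (sf : sigma_finite setT nu) : set T -> \bar R := nu.

Variable sf : sigma_finite setT nu.
HB.instance Definition _ := Measure.copy (as_sigma_finite sf) nu.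
HB.instance Definition _ :=
  Measure_isSigmaFinite.Build _ _ _ (as_sigma_finite sf) sf.

End sigma_finite_bundle.

Theorem theorem3p5 (R : realType) (X : completeMetricType R)
    (nu : {measure set (borel X) -> \bar R}) (f : R -> R) (Ca CA : R)
    (hX : metric_measure_space nu)
    (hnu : nu setT = +oo%E)
    (f_ge0 : forall r : R, 0 <= r -> 0 <= f r)
    (f_convex : convex_function (`[0, +oo[%classic : set R) f)
    (f_incr : forall r s : R, 0 <= r -> r < s -> f r < f s)
    (f0 : f 0 = 0)
    (hCa : 0 < Ca) (hCA : 0 < CA)
    (hreg : ahlfors_regular nu f Ca CA)
    (p : R) (hp : 1 <= p)
    (u : borel X -> R) (hu : u \in Lfun nu p%:E) :
  let normp := ('N[nu]_(p%:E)[EFin \o u] `^ p)%E in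
  let W := weakLp_pow (nu \x nu)%E p (diff_quotient f p u) in
  let phi := fun lam : R =>
    ((lam `^ p)%:E * (nu \x nu) (diff_level f p u lam))%E in
  ((2 * Ca)%:E * normp <= W <= (2 `^ (p + 1) * CA)%:E * normp)%E /\
  ((2 * Ca)%:E * normp <= limf_einf phi 0^'+ /\
   limf_einf phi 0^'+ <= limf_esup phi 0^'+ /\
   limf_esup phi 0^'+ <= (2 * CA)%:E * normp)%E.
Proof.
move=> normp W phi.
have [sepX _ _] := hX.
pose nu' : {sigma_finite_measure set (borel X) -> \bar R} :=
  as_sigma_finite (ahlfors_sigma_finite hreg).
have p0 : 0 < p by rewrite (lt_le_trans _ hp).
have mu : measurable_fun setT u by exact: set_mem (sub_Lfun_mfun hu).
have normpE : normp = (\int[nu]_x (`|u x| `^ p)%:E)%E.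
  by rewrite /normp poweR_Lnorm// gt_eqF.
have normp_lty : (normp < +oo)%E.
  by rewrite /normp poweR_lty//; exact: set_mem (sub_Lfun_finLfun hu).
rewrite normpE in normp_lty *.
pose rho (z : borel X * borel X) := f (mdist (z.1 : X) (z.2 : X)).
have rho_ge0 z : 0 <= rho z by rewrite f_ge0// mdist_ge0.
have rho_gt0 x y : x <> y -> 0 < rho (x, y).
  by move=> /eqP xy; rewrite -f0 f_incr// mdist_gt0.
have rhoC x y : rho (x, y) = rho (y, x) by rewrite /rho /= metric_sym.
have mrho : measurable_fun setT rho by exact: measurable_gauge_dist.
have nu_rho (x : borel X) t : 0 <= t ->
    ((Ca * t)%:E <= nu [set y | (rho (x, y) <= t)%R] <= (CA * t)%:E)%E.
  exact: ahlfors_gauge_ball.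
have Wphi : W = ereal_sup (phi @` [set lam | 0 < lam]).
  congr ereal_sup; apply: eq_imagel => lam _; congr (_ * (_ \x _) _)%E.
  (* The two level sets differ only in the absolute value around the nonnegative denominator. *)
  apply/seteqP; split => z; rewrite /= /diff_quotient normrM normfV.
    by rewrite (ger0_norm (powR_ge0 _ _)).
  by rewrite (ger0_norm (powR_ge0 _ _)).
have einf := @limf_einf_rho_level _ _ _ nu' rho Ca CA mrho rho_ge0 rho_gt0 rhoC
  (ltW hCa) nu_rho p u hp mu normp_lty.
have esup := @limf_esup_rho_level _ _ _ nu' rho Ca CA mrho rho_ge0 rhoC
  (ltW hCA) nu_rho p u hp mu normp_lty.
split; last by do 2 split=> //; exact: limf_einf_le_esup.
rewrite Wphi; apply/andP; split.
  apply: (le_trans einf); apply: limf_einf_le_sup.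
  exact: nbhs_right_gt.
apply/ereal_supP => _ [lam lam0 <-].
exact: (@rho_level_le _ _ _ nu' rho Ca CA mrho rho_ge0 rhoC (ltW hCA) nu_rho).
Qed.
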